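(* For a positive integer $n$, let $A(n)$ denote the number of partitions of $n$ into distinct parts with no $1$'s and a gap of at least $2$ between consecutive parts, and let $B(n)$ denote the number of partitions of $n$ into parts $\equiv 2,3 \pmod 5$. Let $C(n)$ denote the number of partitions of $n$ into distinct parts with no $1$'s appearing, such that if $o_j$ is the $j$-th odd part (where the odd parts are ordered in ascending order), then the even parts $o_j+2j-3$ and $o_j+2j-1$ do not appear. Let $D(n)$ denote the number of partitions of $n$ into distinct parts with no $1$'s appearing, such that if $e_j$ is the $j$-th even part (where the even parts are ordered in ascending order), then the odd parts $e_j+2j-1$ and $e_j+2j+1$ do not appear. Then $A(n)=B(n)=C(n)=D(n)$ for every positive integer $n$.
   Context: The condition in $C(n)$ is imposed for every $j$ from $1$ to the number of odd parts, with $o_1<o_2<\cdots$ all the odd parts of the partition; the condition in $D(n)$ is imposed for every $j$ from $1$ to the number of even parts, with $e_1<e_2<\cdots$ all the even parts. ''Gap of at least $2$ between consecutive parts'' means consecutive parts (in size order) differ by at least $2$. *)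

(* Defs.v *)
From HB Require Import structures.
From mathcomp Require Import all_boot.

Set Implicit Arguments.
Unset Strict Implicit.
Unset Printing Implicit Defensive.

Definition is_partn (n : nat) (s : seq nat) : bool :=
  [&& sorted leq s, all (leq 1) s & sumn s == n].

(* Each partition of n is represented exactly once, by the list of its parts
   in ascending order. *)
Record partn (n : nat) : Type := Partn {
  parts :> seq nat;
  partsP : is_partn n parts
}.

HB.instance Definition _ n := [isSub for @parts n].
HB.instance Definition _ n := [Countable of partn n by <:].

(* A partition of n has at most n parts, all of them at most n; this only
   serves to equip partn n with its finType structure. *)
Definition partn_encode n (p : partn n) : {bseq n of 'I_n.+1} :=
  insub_bseq n [seq inord x | x <- p].

Definition partn_decode n (t : {bseq n of 'I_n.+1}) : option (partn n) :=
  insub [seq nat_of_ord i | i <- t].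

Lemma size_le_sumn s : all (leq 1) s -> size s <= sumn s.
Proof.
elim: s => //= x s IHs /andP[x_gt0 /IHs le_s].
by rewrite -add1n leq_add.
Qed.

Lemma mem_le_sumn s x : x \in s -> x <= sumn s.
Proof.
elim: s => //= y s IHs; rewrite inE => /predU1P[-> | /IHs le_x_s].
  exact: leq_addr.
exact: leq_trans le_x_s (leq_addl _ _).
Qed.

Lemma partn_encodeK n : pcancel (@partn_encode n) (@partn_decode n).
Proof.
move=> p; rewrite /partn_decode /partn_encode.
have /and3P[_ p_gt0 /eqP sum_p] := partsP p.
have le_sz: size [seq (inord x : 'I_n.+1) | x <- p] <= n.
  by rewrite size_map -[X in _ <= X]sum_p size_le_sumn.
rewrite insubdK // -map_comp map_id_in; first exact: valK.
by move=> x /mem_le_sumn; rewrite sum_p => le_x_n /=; rewrite inordK.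
Qed.

HB.instance Definition _ n : isFinite (partn n) :=
  PCanIsFinite (@partn_encodeK n).

Definition distinct_no_ones (s : seq nat) : bool := uniq s && (1 \notin s).

Definition gap_ge2 (s : seq nat) : bool :=
  sorted (fun a b => a + 2 <= b) s.

(* The element s_j of s, with the indexing starting at 1. *)
Definition nth_part (s : seq nat) (j : nat) : nat := nth 0 s j.-1.

Definition odd_parts (s : seq nat) : seq nat := [seq x <- s | odd x].
Definition even_parts (s : seq nat) : seq nat := [seq x <- s | ~~ odd x].

(* iota 1 k = [:: 1; ...; k]. The truncated subtraction is harmless:
   o + 2 * j >= 3 because parts are positive and j >= 1. *)
Definition condC (s : seq nat) : bool :=
  all (fun j => let o := nth_part (odd_parts s) j in
         (o + 2 * j - 3 \notin s) && (o + 2 * j - 1 \notin s))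
      (iota 1 (size (odd_parts s))).

Definition condD (s : seq nat) : bool :=
  all (fun j => let e := nth_part (even_parts s) j in
         (e + 2 * j - 1 \notin s) && (e + 2 * j + 1 \notin s))
      (iota 1 (size (even_parts s))).

Definition A (n : nat) : nat :=
  #|[set p : partn n | distinct_no_ones p && gap_ge2 p]|.

Definition B (n : nat) : nat :=
  #|[set p : partn n | all (fun x => (x == 2 %[mod 5]) || (x == 3 %[mod 5])) p]|.

Definition C (n : nat) : nat :=
  #|[set p : partn n | distinct_no_ones p && condC p]|.

Definition D (n : nat) : nat :=
  #|[set p : partn n | distinct_no_ones p && condD p]|.

(* Main.v *)
(* Generating functions are evaluated at a nilpotent q in a commutative ring,
   at the end q = X in Z[X]/(X^(n+1)): infinite sums and products become
   finite, and 1 - q^i is cancellable for i > 0.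

   Let f m be the generating function of the partitions with gaps at least 2
   and parts greater than m; then f m = f (m+1) + q^(m+1) f (m+2).  Together
   with f m = 1 for large m this determines f, and the Rogers-Selberg
   functions C_{2,2}(q^m) satisfy the same recurrence; the value at m = 1 is
   a theta series, which Jacobi's triple product turns into the product over
   the parts 2, 3 modulo 5.

   For C, the substitution a_j = (o_j + 2j - 3)/2 turns the forbidden even
   parts into the disjoint dominoes {2a_j, 2a_j + 2}.  Scanning the even
   numbers upwards, and recording in e twice the number of dominoes met,
   yields w c e = (1 + q^(c+e)) w (c+2) e + q^(c+1) w (c+2) (e+2), where the
   remaining odd parts start at c + 1 and the remaining even parts at c + e.
   This recurrence implies w c e = w c (e+2) + q^(c+e) w (c+2) e, and the two
   together give w 2 0 = f 1.  D is the same with the parities exchanged,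
   and is counted by w 1 2 = f 1. *)

Require Import Defs.
From mathcomp Require Import all_boot.
From mathcomp Require Import ssralg ssrint poly polydiv qpoly zify ring.

Set Implicit Arguments.
Unset Strict Implicit.
Unset Printing Implicit Defensive.

Import GRing.Theory Pdiv.RingMonic.

Local Open Scope ring_scope.

(** The recurrences below express an index through higher ones and are anchored only beyond [K],
    hence an induction on the distance to [K]. *)
Lemma downward_ind (P : nat -> Prop) (K : nat) :
    (forall m, (K <= m)%N -> P m) -> (forall m, P m.+1 -> P m.+2 -> P m) ->
  forall m, P m.
Proof.
move=> Pbig Pstep m.
have Pd d : forall m, (K <= m + d)%N -> P m.
  elim: d => [|d IHd] k; first by rewrite addn0; apply: Pbig.
  by move=> le_K; apply: Pstep; apply: IHd; lia.
by apply: (Pd K); lia.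
Qed.

(** * Gaussian binomials and the finite triple product *)

Section Gauss.
Variables (R : comNzRingType) (p : R).

(** Gaussian binomials by Pascal's rule, which involves no division and so makes sense in any
    commutative ring. *)
Fixpoint gauss (n k : nat) : R :=
  match n, k with
  | 0, 0 => 1
  | 0, _.+1 => 0
  | _.+1, 0 => 1
  | n'.+1, k'.+1 => gauss n' k'.+1 + p ^+ (n' - k') * gauss n' k'
  end.

Definition qfact (n : nat) : R := \prod_(i < n) (1 - p ^+ i.+1).

Lemma gaussS n k : gauss n.+1 k.+1 = gauss n k.+1 + p ^+ (n - k) * gauss n k.
Proof. by []. Qed.

Lemma gauss0 n : gauss n 0 = 1.
Proof. by case: n. Qed.

Lemma gauss_small n k : (n < k)%N -> gauss n k = 0.
Proof.
elim: n k => [|n IHn] [|k] //=; rewrite ltnS => lt_nk.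
by rewrite !IHn ?mulr0 ?addr0 // ltnW.
Qed.

Lemma gaussnn n : gauss n n = 1.
Proof. by elim: n => // n IHn; rewrite gaussS gauss_small // subnn add0r mul1r. Qed.

Lemma qfactS n : qfact n.+1 = qfact n * (1 - p ^+ n.+1).
Proof. by rewrite /qfact big_ord_recr. Qed.

(** The usual quotient formula cleared of denominators. With [a = p^(n-k)], Pascal's rule reduces it
    to [1 - p^(n+1) = (1 - a) + a (1 - p^(k+1))]. *)
Lemma gauss_fact n k :
  (k <= n)%N -> gauss n k * (qfact k * qfact (n - k)) = qfact n.
Proof.
have qfact0 : qfact 0 = 1 by rewrite /qfact big_ord0.
elim: n k => [|n IHn] [|k] //=; rewrite ?subn0 ?qfact0 ?mul1r ?mulr1 // ltnS.
rewrite leq_eqVlt subSS => /predU1P[->|lt_kn].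
  rewrite gauss_small // add0r subnn expr0 mul1r qfact0 mulr1 qfactS mulrA.
  by have := IHn n (leqnn n); rewrite subnn qfact0 mulr1 => ->.
have IH1 := IHn _ lt_kn; have IH2 := IHn _ (ltnW lt_kn).
have Dnk : (n - k = (n - k.+1).+1)%N by lia.
rewrite [in RHS]qfactS.
have -> : p ^+ n.+1 = p ^+ (n - k) * p ^+ k.+1 by rewrite -exprD; congr (_ ^+ _); lia.
rewrite mulrDl; set a := p ^+ (n - k).
have -> : gauss n k.+1 * (qfact k.+1 * qfact (n - k)) = qfact n * (1 - a).
  by rewrite /a -IH1 {1}Dnk (qfactS (n - k.+1)) -Dnk; ring.
have -> : a * gauss n k * (qfact k.+1 * qfact (n - k)) = a * (1 - p ^+ k.+1) * qfact n.
  by rewrite -IH2 qfactS; ring.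
ring.
Qed.

End Gauss.

Section JacobiTripleProduct.
Variables (R : comNzRingType) (p a b : R).
Hypothesis ab : a * b = p.

(* The coefficient of index j = k - N of the theta series, where b plays the
   part of p / a. *)
Definition theta (N k : nat) : R :=
  if (N <= k)%N then (-1) ^+ (k - N) * p ^+ 'C(k - N, 2) * a ^+ (k - N)
  else (-1) ^+ (N - k) * p ^+ 'C(N - k, 2) * b ^+ (N - k).

(** Consecutive coefficients have ratio [- a p^(k-N)]; the power on the left clears the negative
    exponent that occurs when [k < N]. *)
Lemma thetaS M N k : (k <= M + N)%N ->
  theta N k.+1 * p ^+ (M + N - k) = - (a * p ^+ M) * theta N k.
Proof.
move=> le_k; rewrite /theta; case: (ltngtP N k) => [lt_Nk|lt_kN|->].
- have [-> ->] : (N <= k.+1)%N /\ (k.+1 - N = (k - N).+1)%N by lia.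
  rewrite binS bin1 !exprS exprD -[in RHS](subnK (_ : k - N <= M)%N); last by lia.
  have -> : (M + N - k = M - (k - N))%N by lia.
  rewrite exprD; ring.
- case: (ltnP N k.+1) => [|lt_kN']; first by lia.
  have Dk : (N - k = (N - k.+1).+1)%N by lia.
  case: leqP => [le_N|lt_kN2].
    have DN : N = k.+1 by lia.
    rewrite DN !subnn subSn // subnn /= !expr0 !expr1 !mul1r mulr1.
    have -> : (M + k.+1 - k = M.+1)%N by lia.
    rewrite exprS -ab; ring.
  rewrite Dk binS bin1 !exprS exprD.
  have -> : (M + N - k = M + (N - k.+1) + 1)%N by lia.
  rewrite !exprD expr1; move: (p ^+ M) (p ^+ _) (p ^+ _) (b ^+ _) ((-1) ^+ _).
  by move=> x y z t s; rewrite -ab; ring.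
- rewrite leqnSn subnn subSnn addnK /= !bin_small ?ltnS // !expr0 !expr1; ring.
Qed.

Lemma gauss_recl n (F : nat -> R) :
  \sum_(k < n.+2) F k * gauss p n.+1 k =
  \sum_(k < n.+1) (F k + F k.+1 * p ^+ (n - k)) * gauss p n k.
Proof.
rewrite big_ord_recl gauss0 mulr1.
under eq_bigr do rewrite lift0 gaussS mulrDr.
rewrite big_split /= addrA.
have -> : F 0%N + \sum_(k < n.+1) F k.+1 * gauss p n k.+1
        = \sum_(k < n.+1) F k * gauss p n k.
  rewrite [LHS](_ : _ = \sum_(k < n.+2) F k * gauss p n k).
    by rewrite big_ord_recr /= gauss_small // mulr0 addr0.
  by rewrite [RHS]big_ord_recl gauss0 mulr1; under [in RHS]eq_bigr do rewrite lift0.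
by rewrite -big_split; apply: eq_bigr => k _; rewrite mulrDl !mulrA.
Qed.

(** The q-binomial theorem, summed in reverse so as to be the case [M = 0] of the triple product.
    Pascal's rule splits off [1 - c] and replaces [c] by [c * p]. *)
Lemma gauss_binomial n c :
  \sum_(k < n.+1) (-1) ^+ (n - k) * p ^+ 'C(n - k, 2) * c ^+ (n - k) * gauss p n k
  = \prod_(i < n) (1 - c * p ^+ i).
Proof.
elim: n c => [|n IHn] c.
  by rewrite big_ord_recl !big_ord0 addr0 bin0n /= !mulr1.
pose F k := (-1) ^+ (n.+1 - k) * p ^+ 'C(n.+1 - k, 2) * c ^+ (n.+1 - k).
rewrite (gauss_recl n F) big_ord_recl expr0 mulr1.
under [in RHS]eq_bigr do rewrite lift0 exprS mulrA.
rewrite -IHn mulr_sumr; apply: eq_bigr => k _.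
rewrite /F subSS (_ : n.+1 - k = (n - k).+1)%N; last by have := ltn_ord k; lia.
rewrite binS bin1 !exprS exprD exprMn; ring.
Qed.

(** Pascal's rule and the ratio of theta coefficients produce the factor [1 - a p^M] at each step in
    [M]. *)
Lemma finite_triple_product M N :
  \sum_(k < (M + N).+1) theta N k * gauss p (M + N) k =
  \prod_(i < M) (1 - a * p ^+ i) * \prod_(i < N) (1 - b * p ^+ i).
Proof.
elim: M => [|M IHM].
  rewrite big_ord0 mul1r -gauss_binomial add0n; apply: eq_bigr => k _.
  have := ltn_ord k; rewrite ltnS leq_eqVlt /theta => /predU1P[->|lt_kN].
    by rewrite leqnn subnn.
  by rewrite leqNgt lt_kN.
rewrite addSn gauss_recl [in RHS]big_ord_recr /= mulrAC -IHM mulr_suml.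
apply: eq_bigr => k _; rewrite thetaS; [ring | by have := ltn_ord k; lia].
Qed.
End JacobiTripleProduct.

(** * The Rogers-Selberg functions *)

Section Nilpotent.
Variables (R : comNzRingType) (q : R) (K : nat).
Hypothesis qK : q ^+ K = 0.

Lemma expr_nilp i : (K <= i)%N -> q ^+ i = 0.
Proof. by move=> le_Ki; rewrite -(subnK le_Ki) exprD qK mulr0. Qed.

(** The difference satisfies [z = q^(i+1) z]; iterating this [K] times kills [z]. *)
Lemma lreg_1subX i : GRing.lreg (1 - q ^+ i.+1).
Proof.
move=> x y eq_xy; apply/eqP; rewrite -subr_eq0; apply/eqP; set z := x - y.
have Dz : z = q ^+ i.+1 * z.
  apply/eqP; rewrite -subr_eq0 -{1}[z]mul1r -mulrBl /z mulrBr eq_xy subrr //.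
have Dzn n : z = q ^+ (i.+1 * n) * z.
  elim: n => [|n IHn]; first by rewrite muln0 mul1r.
  by rewrite mulnS exprD -mulrA -IHn.
by rewrite (Dzn K) expr_nilp ?mul0r // leq_pmull.
Qed.

Lemma lreg_qfact_exp d n : GRing.lreg (qfact (q ^+ d.+1) n).
Proof.
elim: n => [|n IHn]; first by rewrite /qfact big_ord0; apply: lreg1.
by rewrite qfactS; apply: lregM => //; rewrite -exprM mulnS; apply: lreg_1subX.
Qed.

Lemma lreg_qfact n : GRing.lreg (qfact q n).
Proof. by have := @lreg_qfact_exp 0 n; rewrite expr1. Qed.

Lemma gauss_shift m n :
  (1 - q ^+ m.+1) * gauss q (m.+1 + n) n = (1 - q ^+ (m + n).+1) * gauss q (m + n) n.
Proof.
apply: (lregM (@lreg_qfact n) (@lreg_qfact m)).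
have := gauss_fact q (leq_addl m n); have := gauss_fact q (leq_addl m.+1 n).
rewrite !addnK addSn !qfactS => + E0; rewrite -E0 => E1.
by transitivity (gauss q (m + n).+1 n * (qfact q n * (qfact q m * (1 - q ^+ m.+1))));
  [|rewrite E1]; ring.
Qed.

Lemma gauss_shiftS m n :
  (1 - q ^+ n.+1) * gauss q (m + n.+1) n.+1 = (1 - q ^+ (m + n).+1) * gauss q (m + n) n.
Proof.
apply: (lregM (@lreg_qfact n) (@lreg_qfact m)).
have := gauss_fact q (leq_addl m n); have := gauss_fact q (leq_addl m n.+1).
rewrite !addnK addnS !qfactS => + E0; rewrite -E0 => E1.
by transitivity (gauss q (m + n).+1 n.+1 * (qfact q n * (1 - q ^+ n.+1) * qfact q m));
  [|rewrite E1]; ring.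
Qed.

(** With [x = q^m] the Gaussian binomial is [(1 - xq)...(1 - xq^n) / ((1 - q)...(1 - q^n))], so the
    terms carry no denominators. *)
Definition rs_term m n : R :=
  (-1) ^+ n * q ^+ ('C(n, 2) * 5 + n * 3 + m * n * 2) * gauss q (m + n) n.

(* With x = q ^+ m, these are the functions C_{2,2}(x) and C_{2,1}(x) of
   Rogers and Selberg, multiplied by (1 - xq)(1 - xq^2)... *)
Definition rs_sum2 m := \sum_(n < K) rs_term m n * (1 - q ^+ (m * 2 + n * 4 + 2)).
Definition rs_sum1 m := \sum_(n < K) rs_term m n * q ^+ n * (1 - q ^+ (m + n * 2 + 1)).

Lemma rs_termS m n :
  rs_term m n.+1 * (1 - q ^+ n.+1) =
  - q ^+ (m * 2 + n * 5 + 3) * (1 - q ^+ (m + n).+1) * rs_term m n.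
Proof.
rewrite /rs_term binS bin1.
transitivity ((-1) ^+ n.+1 * q ^+ (('C(n, 2) + n) * 5 + n.+1 * 3 + m * n.+1 * 2)
   * ((1 - q ^+ n.+1) * gauss q (m + n.+1) n.+1)); first ring.
rewrite gauss_shiftS exprS.
have -> : (('C(n, 2) + n) * 5 + n.+1 * 3 + m * n.+1 * 2 =
  'C(n, 2) * 5 + n * 3 + m * n * 2 + (m * 2 + n * 5 + 3))%N by lia.
rewrite [q ^+ (_ + (m * 2 + _ + _))]exprD; ring.
Qed.

Lemma rs_term_shift m n :
  (1 - q ^+ m.+1) * rs_term m.+1 n = q ^+ (n * 2) * (1 - q ^+ (m + n).+1) * rs_term m n.
Proof.
rewrite /rs_term.
transitivity ((-1) ^+ n * q ^+ ('C(n, 2) * 5 + n * 3 + m.+1 * n * 2)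
   * ((1 - q ^+ m.+1) * gauss q (m.+1 + n) n)); first ring.
rewrite gauss_shift.
have -> : ('C(n, 2) * 5 + n * 3 + m.+1 * n * 2 =
  'C(n, 2) * 5 + n * 3 + m * n * 2 + n * 2)%N by lia.
rewrite [q ^+ (_ + n * 2)]exprD; ring.
Qed.

Lemma rs_telescope (u : nat -> R) : u 0%N = 0 -> u K = 0 ->
  \sum_(n < K) (u n - u n.+1) = 0.
Proof.
move=> u0 uK; rewrite -(big_mkord xpredT (fun n => u n - u n.+1)).
under eq_bigr do rewrite -opprB.
by rewrite sumrN telescope_sumr // u0 uK subrr oppr0.
Qed.

Lemma rs_term_K m : rs_term m K = 0.
Proof. by rewrite /rs_term expr_nilp ?mulr0 ?mul0r //; lia. Qed.

(** The difference of the two sides telescopes. The factor [1 - q^n] of the telescoping sequence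
    makes it vanish at [n = 0] and lets [rs_termS] bring the term of index [n + 1] back to index
    [n]. *)
Lemma rs_sum1E m : rs_sum1 m = (1 - q ^+ m.+1) * rs_sum2 m.+1.
Proof.
apply/eqP; rewrite -subr_eq0; apply/eqP.
rewrite -[RHS](@rs_telescope (fun n => rs_term m n * q ^+ n * (1 - q ^+ n))).
- rewrite /rs_sum1 /rs_sum2 mulr_sumr -sumrB; apply: eq_bigr => n _.
  rewrite mulrA rs_term_shift [rs_term m n.+1 * _ * _]mulrAC rs_termS.
  rewrite -addn1 !(exprD, exprM, mulSn, exprS, expr0).
  ring.
- by rewrite subrr mulr0.
- by rewrite rs_term_K !mul0r.
Qed.

Lemma rs_sum2E m :
  rs_sum2 m = rs_sum1 m + q ^+ m.+1 * ((1 - q ^+ m.+1) * rs_sum1 m.+1).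
Proof.
apply/eqP; rewrite -subr_eq0 opprD addrA; apply/eqP.
rewrite -[RHS](@rs_telescope (fun n => rs_term m n * (1 - q ^+ n))).
- rewrite /rs_sum1 /rs_sum2 !mulr_sumr -!sumrB; apply: eq_bigr => n _.
  rewrite rs_termS [X in _ - X = _](_ : _ =
    q ^+ m.+1 * ((1 - q ^+ m.+1) * rs_term m.+1 n)
    * q ^+ n * (1 - q ^+ (m.+1 + n * 2 + 1))); last by ring.
  rewrite rs_term_shift.
  rewrite -addn1 !(exprD, exprM, mulSn, exprS, expr0).
  ring.
- by rewrite subrr mulr0.
- by rewrite rs_term_K !mul0r.
Qed.

Lemma rs_sum2_rec m :
  rs_sum2 m = (1 - q ^+ m.+1) * rs_sum2 m.+1 +
    q ^+ m.+1 * ((1 - q ^+ m.+1) * ((1 - q ^+ m.+2) * rs_sum2 m.+2)).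
Proof. by rewrite rs_sum2E !rs_sum1E. Qed.

(** The infinite product [(1 - xq)(1 - xq^2)...] at [x = q^m]: the factors left out are 1. *)
Definition tail_qfact m : R := \prod_(m <= i < K) (1 - q ^+ i.+1).

Lemma tail_qfact_rec m : tail_qfact m = (1 - q ^+ m.+1) * tail_qfact m.+1.
Proof.
rewrite /tail_qfact; have [lt_mK|le_Km] := ltnP m K; first by rewrite big_ltn.
by rewrite !big_geq ?(leq_trans le_Km) // expr_nilp ?subr0 ?mulr1 // leqW.
Qed.

Section GapSequences.
Variable f : nat -> R.
Hypothesis f_big : forall m, (K <= m)%N -> f m = 1.
Hypothesis f_rec : forall m, f m = f m.+1 + q ^+ m.+1 * f m.+2.

(** Both sides satisfy [rs_sum2_rec], and both are 1 from [K] on. *)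
Lemma gap_rs_sum2 m : tail_qfact m * f m = rs_sum2 m.
Proof.
move: m; apply: (@downward_ind _ K) => [m le_Km|m IH1 IH2]; last first.
  rewrite rs_sum2_rec -IH1 -IH2 f_rec [tail_qfact m]tail_qfact_rec.
  rewrite [tail_qfact m.+1]tail_qfact_rec; ring.
rewrite f_big // /tail_qfact big_geq // /rs_sum2 mulr1.
(* [K = 0] would give [1 = q^0 = 0]; otherwise the term [n = 0] exists, and it alone survives. *)
case: (posnP K) => [K0|K_gt0].
  by have := oner_neq0 R; rewrite -(expr0 q) -[in q ^+ _]K0 qK eqxx.
rewrite (bigD1 (Ordinal K_gt0)) //= big1 => [|[[|n] lt_nK] // _] /=.
  by rewrite /rs_term gauss0 bin0n muln0 /= !mul1r addr0 expr_nilp ?subr0 //; lia.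
by rewrite /rs_term expr_nilp ?mulr0 ?mul0r //; nia.
Qed.

(** Multiplying the case [m = 1] by [1 - q] leads to index 0, where the Gaussian binomials are 1 and
    the sum is a theta series. *)
Lemma gap1_rs_sum1 : qfact q K * f 1 = rs_sum1 0.
Proof.
rewrite rs_sum1E -gap_rs_sum2 mulrA -tail_qfact_rec.
by rewrite /tail_qfact /qfact big_mkord.
Qed.
End GapSequences.

Lemma qfact_nilp d n : (K <= n)%N -> qfact (q ^+ d.+1) n = qfact (q ^+ d.+1) K.
Proof.
elim: n => [|n IHn]; first by rewrite leqn0 => /eqP ->.
rewrite leq_eqVlt => /predU1P[-> //|]; rewrite ltnS => le_Kn.
rewrite qfactS IHn // -exprM [q ^+ (_ * _)]expr_nilp ?subr0 ?mulr1 //.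
by rewrite mulSn (leq_trans le_Kn) // (leq_trans (leqnSn n)) ?leq_addr.
Qed.

(** Far from both ends of its row a Gaussian binomial has reached its limit, since the three [qfact]
    in [gauss_fact] all equal the one at [K]. *)
Lemma gauss_nilp d n k : (K <= k)%N -> (K + k <= n)%N ->
  qfact (q ^+ d.+1) K * gauss (q ^+ d.+1) n k = 1.
Proof.
move=> le_Kk le_kn; apply: (@lreg_qfact_exp d K); rewrite mulr1.
have [le_kn' le_Kn le_Knk] : [/\ k <= n, K <= n & K <= n - k]%N by split; lia.
have := gauss_fact (q ^+ d.+1) le_kn'.
rewrite (qfact_nilp _ le_Kn) (qfact_nilp _ le_Kk) (qfact_nilp _ le_Knk) => E.
by rewrite -[RHS]E; ring.
Qed.

(** * The theta series and the product modulo 5 *)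

Let p := q ^+ 5.
(** With this centre, an index of [0..N+N] either lies at least [K] from both ends, where
    [gauss_nilp] applies, or is so far from [N] that its theta coefficient is 0. *)
Let N := (K + K)%N.
Let q4q : q ^+ 4 * q = p. Proof. by rewrite -exprSr. Qed.
Let th := theta p (q ^+ 4) q N.

Lemma theta_right j : th (N + j)%N = rs_term 0 j * q ^+ j.
Proof.
rewrite /th /theta leq_addr addKn /rs_term gaussnn -!exprM mul0n addn0 mulr1.
by rewrite -!mulrA -!exprD; congr (_ * _ ^+ _); lia.
Qed.

Lemma theta_left j : (j < N)%N ->
  th (N - j.+1)%N = - (rs_term 0 j * q ^+ j * q ^+ (0 + j * 2 + 1)).
Proof.
move=> lt_jN; rewrite /th /theta leqNgt ltn_subrL (leq_trans _ lt_jN) //=.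
rewrite subKn // /rs_term gaussnn -!exprM mul0n addn0 mulr1 binS bin1 exprS.
by rewrite -!mulrA mulN1r -!exprD; congr (- (_ * _ ^+ _)); lia.
Qed.

Lemma rs_term_far j : (K <= j)%N -> rs_term 0 j * q ^+ j = 0.
Proof. by move=> le_Kj; rewrite expr_nilp ?mulr0. Qed.

(** The indices [N + j] and [N - (j + 1)] give the two halves of the factor [1 - q^(2j+1)] in the
    [j]-th term. *)
Lemma theta_sum : \sum_(k < (N + N).+1) th k = rs_sum1 0.
Proof.
have -> : rs_sum1 0 = \sum_(0 <= n < N)
    rs_term 0 n * q ^+ n * (1 - q ^+ (0 + n * 2 + 1)).
  rewrite (@big_cat_nat _ _ _ K) ?leq_addr //= big_mkord.
  rewrite [X in _ = _ + X]big_nat_cond [X in _ = _ + X]big1 ?addr0 //.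
  by move=> n /andP[/andP[le_Kn _] _]; rewrite rs_term_far ?mul0r.
rewrite -(big_mkord xpredT th) (@big_cat_nat _ _ _ N) //=; last by lia.
have -> : \sum_(N <= k < (N + N).+1) th k = \sum_(0 <= j < N.+1) th (j + N)%N.
  by rewrite -{1}[N]add0n big_addn -addSn addnK.
rewrite big_nat_rev /=.
(* The last index [N + N] has no partner on the left, but its coefficient vanishes. *)
rewrite big_nat_recr //= theta_right rs_term_far ?leq_addr // addr0.
rewrite addrC -big_split; apply: eq_big_nat => j /andP[_ lt_jN] /=.
by rewrite add0n [(j + N)%N]addnC theta_right theta_left // mulrBr mulr1.
Qed.

Lemma theta_product :
  rs_sum1 0 = qfact p N *
    (\prod_(i < N) (1 - q ^+ 4 * p ^+ i) * \prod_(i < N) (1 - q * p ^+ i)).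
Proof.
rewrite -(finite_triple_product q4q) mulr_sumr -theta_sum.
apply: eq_bigr => [[k lt_k] _] /=; rewrite -/th mulrCA qfact_nilp ?leq_addr //.
have [/andP[le_Kk le_kN]|far] := boolP ((K <= k) && (K + k <= N + N))%N.
  by rewrite gauss_nilp ?mulr1.
suff -> : th k = 0 by rewrite mul0r.
have [le_Nk|lt_kN] := leqP N k.
  by rewrite -(subnKC le_Nk) theta_right rs_term_far //; lia.
rewrite (_ : k = N - (N - k.+1).+1)%N ?theta_left ?rs_term_far; try lia.
by rewrite mul0r oppr0.
Qed.

(** The factors are sorted by exponent modulo 5: residue 0, then 4 and 1, then 2 and 3. *)
Lemma qfact_mod5 n : qfact q (n * 5) =
  qfact p n * (\prod_(i < n) (1 - q ^+ 4 * p ^+ i) * \prod_(i < n) (1 - q * p ^+ i))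
  * \prod_(i < n) ((1 - q ^+ (i * 5 + 2)) * (1 - q ^+ (i * 5 + 3))).
Proof.
elim: n => [|n IHn]; first by rewrite /qfact !big_ord0 !mulr1.
have Ep : p ^+ n = (q ^+ n) ^+ 5 by rewrite -!exprM mulnC.
rewrite mulSn !big_ord_recr /= !qfactS IHn [p ^+ n.+1]exprS Ep /p.
rewrite !(exprD, exprS, expr0, exprM).

set u := (_ ^+ n); ring.
Qed.

Lemma rogers_ramanujan f : (forall m, (K <= m)%N -> f m = 1) ->
    (forall m, f m = f m.+1 + q ^+ m.+1 * f m.+2) ->
  f 1%N * \prod_(i < N) ((1 - q ^+ (i * 5 + 2)) * (1 - q ^+ (i * 5 + 3))) = 1.
Proof.
move=> f_big f_rec; have := gap1_rs_sum1 f_big f_rec.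
have -> : qfact q K = qfact q (N * 5).
  by have := @qfact_nilp 0 (N * 5); rewrite expr1 => -> //; lia.
rewrite theta_product qfact_mod5.
set P := qfact p N * _; set P' := \prod_(i < N) _ => EP.
(* [P] collects the residues 0, 1 and 4, which occur on both sides; as a product of regular elements
   it cancels. *)
suff /(_ (f 1%N * P') 1) : GRing.lreg P by apply; rewrite mulr1 -[RHS]EP; ring.
apply: lregM; first exact: lreg_qfact_exp.
apply: lregM; elim/big_ind: _ => [||i _]; try exact: lreg1; try exact: lregM.
  by rewrite -exprM -exprD; apply: lreg_1subX.
by rewrite -exprM -exprS; apply: lreg_1subX.
Qed.

(** * The two recurrences of the domino scan *)

Section DominoRecurrence.
Variables (f : nat -> R) (w : nat -> nat -> R).
Hypothesis f_big : forall m, (K <= m)%N -> f m = 1.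
Hypothesis f_rec : forall m, f m = f m.+1 + q ^+ m.+1 * f m.+2.
Hypothesis w_big : forall c e, (K <= c)%N -> w c e = 1.
Hypothesis w_rec : forall c e,
  w c e = (1 + q ^+ (c + e)) * w c.+2 e + q ^+ c.+1 * w c.+2 e.+2.

(* The difference d of the two sides satisfies the homogeneous recurrence
   d c e = (1 + q^(c+e+2)) d (c+2) e + q^(c+1) d (c+2) (e+2). *)
Lemma domino_rec2 c e : w c e = w c e.+2 + q ^+ (c + e) * w c.+2 e.
Proof.
move: c e; apply: (@downward_ind _ K) => [c le_Kc e|c _ IHc e].
  by rewrite !w_big ?expr_nilp ?mul0r ?addr0 //; lia.
have /eqP := IHc e; have /eqP := IHc e.+2.
rewrite -subr_eq0 => /eqP IH2; rewrite -subr_eq0 => /eqP IH0.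
apply/eqP; rewrite -subr_eq0; apply/eqP.
transitivity ((1 + q ^+ (c + e) * q ^+ 2)
    * (w c.+2 e - (w c.+2 e.+2 + q ^+ (c.+2 + e) * w c.+4 e))
  + q ^+ c.+1 * (w c.+2 e.+2 - (w c.+2 e.+4 + q ^+ (c.+2 + e.+2) * w c.+4 e.+2))).
  rewrite [w c e]w_rec [w c e.+2]w_rec [w c.+2 e]w_rec.
  rewrite !addnS !addSn !exprS; ring.
by rewrite IH0 IH2 !mulr0 addr0.
Qed.

(** Two expressions of [w c e] are compared. *)
Lemma domino_rec3 c e : w c e.+2 = w c.+2 e + q ^+ c.+1 * w c.+2 e.+2.
Proof.
apply: (addIr (q ^+ (c + e) * w c.+2 e)).
by rewrite -domino_rec2 w_rec; ring.
Qed.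

(** The value at 4 is carried along because [domino_rec3] at [e = 2] calls for it; the pair is then
    closed under the recurrences. *)
Lemma domino_gap c : w c 2 = f c /\ w c 4 = f c - q ^+ c.+2 * f c.+2.
Proof.
move: c; apply: (@downward_ind _ K) => [c le_Kc|c _ [IH2 IH4]].
  by rewrite !w_big ?f_big ?expr_nilp ?mul0r ?subr0 //; lia.
have E4 : w c 4 = f c - q ^+ c.+2 * f c.+2.
  rewrite domino_rec3 IH2 IH4 [f c]f_rec [f c.+1]f_rec [f c.+2]f_rec.
  rewrite !exprS; ring.
by split=> //; rewrite domino_rec2 E4 IH2 addn2 subrK.
Qed.

Lemma domino_w12 : w 1 2 = f 1.
Proof. by case: (domino_gap 1). Qed.

(** [domino_rec3] at [c = e = 0] reads [f 0 = w 2 0 + q f 2], while [f 0 = f 1 + q f 2]. *)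
Lemma domino_w20 : w 2 0 = f 1.
Proof.
have := domino_rec3 0 0; have [-> _] := domino_gap 0; have [-> _] := domino_gap 2.
by rewrite f_rec => /addIr.
Qed.

End DominoRecurrence.

End Nilpotent.

(** * Enumerations of the four families *)

(** [L] may contain lists of any sum, so that it can also carry a recursively computed generating
    function. *)
Lemma card_partn n (P : pred (seq nat)) (L : seq (seq nat)) : uniq L ->
    (forall s, is_partn n s && P s = (s \in L) && (sumn s == n)) ->
  #|[set p : Defs.partn n | P p]| = count (fun s => sumn s == n) L.
Proof.
move=> uniqL memL; rewrite -size_filter cardE -(size_map val).
apply/perm_size/uniq_perm; rewrite ?filter_uniq ?map_inj_uniq ?enum_uniq //.
  exact: val_inj.
move=> s; rewrite mem_filter andbC -memL; apply/mapP/idP => [[p + ->]|/andP[s_n Ps]].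
  by rewrite mem_enum inE => ->; rewrite andbT; apply: partsP.
by exists (Partn s_n); rewrite ?mem_enum ?inE.
Qed.

Definition gen_fun (R : comNzRingType) (q : R) (L : seq (seq nat)) : R :=
  \sum_(s <- L) q ^+ sumn s.

(** In [Z[X]/(X^(n+1))] the lists of sum above [n] contribute 0, and the coefficient of [X^n] is the
    count. *)
Lemma count_gen_fun n (L1 L2 : seq (seq nat)) :
    (forall (R : comNzRingType) (q : R), q ^+ n.+1 = 0 -> gen_fun q L1 = gen_fun q L2) ->
  count (fun s => sumn s == n) L1 = count (fun s => sumn s == n) L2.
Proof.
pose h : {poly int} := 'X^(n.+1); pose q := in_qpoly h 'X.
have mk_h : mk_monic h = h by rewrite /h mk_monic_Xn.
have Eq k : q ^+ k = in_qpoly h 'X^k by rewrite rmorphXn.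
have q_n : q ^+ n.+1 = 0.
  by rewrite Eq; apply: val_inj; rewrite /= mk_h rmodpp // monicXn.
move=> /(_ _ q q_n).
suff coefL L : (gen_fun q L : {poly int})`_n = (count (fun s => sumn s == n) L)%:R.
  by move/(congr1 (fun x : {poly %/ h} => (x : {poly int})`_n)); rewrite !coefL; lia.
rewrite /gen_fun poly_of_qpoly_sum coef_sum -sum1_count natr_sum [RHS]big_mkcond.
apply: eq_bigr => s _.
have [le_sn|lt_ns] := leqP (sumn s) n.
  rewrite Eq in_qpoly_small ?coefXn; first by rewrite eq_sym; case: eqP.
  by rewrite mk_h !size_polyXn ltnS.
rewrite -(subnK lt_ns) exprD q_n mulr0 coef0 ifN //; lia.
Qed.

Lemma gen_fun_cat (R : comNzRingType) (q : R) L1 L2 :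
  gen_fun q (L1 ++ L2) = gen_fun q L1 + gen_fun q L2.
Proof. exact: big_cat. Qed.

(** * Partitions with gaps at least 2 *)

Section GapSequences.
Local Open Scope nat_scope.

(* The fuel n bounds the parts reached by the recursion: the lists with gaps at
   least 2 and all parts in (m, m+n] occur, along with some larger ones. *)
Fixpoint gapseqs (n m : nat) : seq (seq nat) :=
  if n is n'.+1 then gapseqs n' m.+1 ++ map (cons m.+1) (gapseqs n' m.+2)
  else [:: [::]].

Definition gap_above (m : nat) (s : seq nat) : bool := gap_ge2 s && all (ltn m) s.

Lemma gap_above_cons m x s : gap_above m (x :: s) = (m < x) && gap_above x.+1 s.
Proof.
rewrite /gap_above /gap_ge2 /= path_sortedE; last by move=> a b c; lia.
have -> : all (fun b => x + 2 <= b) s = all (ltn x.+1) s by apply: eq_all => b /=; lia.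
have [lt_mx|_] := ltnP m x; last by rewrite andbF.
rewrite andbC /= andbA [X in X && _ = _]andb_idl; first exact: andbC.
by move=> /(sub_all _); apply=> b /=; lia.
Qed.

Lemma gap_above_leq m m' s : m <= m' -> gap_above m' s -> gap_above m s.
Proof.
by case: s => // x s le_m; rewrite !gap_above_cons => /andP[lt_m ->]; rewrite andbT; lia.
Qed.

Lemma gapseqs_sound n m s : s \in gapseqs n m -> gap_above m s.
Proof.
elim: n m s => [|n IHn] m s /=; first by rewrite inE => /eqP ->.
rewrite mem_cat => /orP[/IHn|/mapP[s' /IHn gap_s' ->]].
  exact: gap_above_leq.
by rewrite gap_above_cons ltnSn.
Qed.

Lemma gapseqs_complete n m s :
  gap_above m s -> all (geq (m + n)) s -> s \in gapseqs n m.
Proof.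
elim: n m s => [|n IHn] m [|x s] //=; first by rewrite gap_above_cons; lia.
  by move=> _ _; rewrite mem_cat IHn.
rewrite gap_above_cons mem_cat => /andP[lt_mx gap_s] /andP[le_x le_s].
(* The two branches of the enumeration: the least admissible part [m + 1] occurs or not. *)
have [Dx|neq_x] := eqVneq x m.+1.
  rewrite orbC Dx map_f // IHn -?Dx //; apply: sub_all le_s => y /=; lia.
rewrite IHn //= ?gap_above_cons ?gap_s; first by rewrite andbT; lia.
by apply/andP; split; [lia | apply: sub_all le_s => y /=; lia].
Qed.

Lemma gapseqs_uniq n m : uniq (gapseqs n m).
Proof.
elim: n m => // n IHn m; rewrite /= cat_uniq IHn map_inj_uniq ?IHn => [|s1 s2 []] //.
rewrite andbT; apply/hasPn => _ /mapP[s _ ->]; apply/negP => /gapseqs_sound.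
by rewrite gap_above_cons ltnn.
Qed.

End GapSequences.

Section GapGenFun.
Variables (R : comNzRingType) (q : R) (K : nat).
Hypothesis qK : q ^+ K = 0.

Lemma gen_fun_cons x L : gen_fun q (map (cons x) L) = q ^+ x * gen_fun q L.
Proof. by rewrite /gen_fun big_map mulr_sumr; apply: eq_bigr => s _; rewrite -exprD. Qed.

Lemma gen_fun_gapseqs_big n m : (K <= m)%N -> gen_fun q (gapseqs n m) = 1.
Proof.
elim: n m => [|n IHn] m le_Km; first by rewrite /gen_fun big_seq1.
by rewrite gen_fun_cat gen_fun_cons (expr_nilp qK) ?mul0r ?addr0 ?IHn // leqW.
Qed.

(** Lists present on one side only contain a part above [m + n], so their weight is 0. This closes
    the recurrence at the fixed fuel [K]. *)
Lemma gen_fun_gapseqs_stable n m : (K <= m + n)%N ->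
  gen_fun q (gapseqs n.+1 m) = gen_fun q (gapseqs n m).
Proof.
elim: n m => [|n IHn] m le_K; first by rewrite !gen_fun_gapseqs_big // -[m]addn0.
rewrite [LHS]gen_fun_cat [RHS]gen_fun_cat !gen_fun_cons !IHn //; lia.
Qed.

Lemma gen_fun_gapseqs_rec m : gen_fun q (gapseqs K m) =
  gen_fun q (gapseqs K m.+1) + q ^+ m.+1 * gen_fun q (gapseqs K m.+2).
Proof.
by rewrite -gen_fun_gapseqs_stable ?leq_addl // gen_fun_cat gen_fun_cons.
Qed.

End GapGenFun.

Lemma card_A n : A n = count (fun s => sumn s == n) (gapseqs n.+1 1).
Proof.
apply: (@card_partn n (fun s => distinct_no_ones s && gap_ge2 s)).
  exact: gapseqs_uniq.
move=> s; apply/idP/idP.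
  case/andP=> /and3P[_ s_gt0 /eqP sum_s] /andP[/andP[_ no1] gap_s].
  rewrite sum_s eqxx andbT; apply: gapseqs_complete.
    rewrite /gap_above gap_s; apply/allP => x s_x /=; rewrite ltn_neqAle (allP s_gt0) //.
    by rewrite andbT; apply: contraNneq no1 => ->.
  by apply/allP => x /mem_le_sumn; rewrite sum_s /=; lia.
case/andP=> /gapseqs_sound/andP[gap_s s_gt1] sum_s.
have lt_s : sorted ltn s by apply: sub_sorted gap_s => x y; lia.
rewrite /is_partn sum_s gap_s /distinct_no_ones (sorted_uniq ltn_trans ltnn) //.
rewrite !andbT /= (sub_sorted ltnW) //=.
rewrite (sub_all _ s_gt1) /=; last by move=> x /ltnW.
by apply/negP => /(allP s_gt1).
Qed.

(** * Partitions into prescribed parts *)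

Section PartsIn.
Local Open Scope nat_scope.

(** A multiplicity below [K] is chosen for each part. *)
Fixpoint partseqs (K : nat) (ps : seq nat) : seq (seq nat) :=
  if ps is p :: ps' then [seq nseq k p ++ s | k <- iota 0 K, s <- partseqs K ps']
  else [:: [::]].

Lemma partseqs_sound K ps s : sorted ltn ps ->
  s \in partseqs K ps -> sorted leq s && all (mem ps) s.
Proof.
elim: ps s => [|p ps IHps] s; first by rewrite inE => _ /eqP ->.
rewrite [sorted _ _]path_sortedE; last exact: ltn_trans.
move=> /andP[p_lt sorted_ps] /allpairsP[[k t] /= [_ /(IHps _ sorted_ps) + ->]].
case/andP=> sorted_t /allP t_ps; apply/andP; split.
  elim: k => //= k; rewrite (path_sortedE leq_trans) => ->; rewrite andbT.
  rewrite all_cat all_nseq leqnn orbT; apply/allP => x /t_ps /(allP p_lt); exact: ltnW.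
apply/allP => x; rewrite mem_cat mem_nseq !inE => /orP[/andP[_ ->] //|/t_ps].
by rewrite inE orbC => ->.
Qed.

Lemma sorted_leq_nseq p s : sorted leq s -> all (leq p) s ->
  exists k s', s = nseq k p ++ s' /\ all (ltn p) s'.
Proof.
elim: s => [|x s IHs]; first by exists 0, [::].
rewrite /= (path_sortedE leq_trans) => /andP[x_le sorted_s] /andP[le_px p_le].
have [-> | neq_xp] := eqVneq x p.
  by have [k [s' [-> gt_s']]] := IHs sorted_s p_le; exists k.+1, s'.
exists 0, (x :: s); split=> //=; have lt_px : p < x by lia.
by rewrite lt_px; apply: sub_all x_le => y; apply: leq_trans.
Qed.

Lemma partseqs_complete K ps s : sorted ltn ps -> sorted leq s -> all (mem ps) s ->
  size s < K -> s \in partseqs K ps.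
Proof.
elim: ps s => [|p ps IHps] s; first by case: s => // x s _ _ /=.
rewrite [sorted _ _]path_sortedE; last exact: ltn_trans.
move=> /andP[p_lt sorted_ps] sorted_s s_ps.
have p_le : all (leq p) s.
  by apply: sub_all s_ps => x /predU1P[->//|/(allP p_lt)/ltnW].
have [k [t [Ds t_gt]]] := sorted_leq_nseq sorted_s p_le.
move: sorted_s s_ps; rewrite Ds size_cat size_nseq => /cat_sorted2[_ sorted_t] s_ps lt_K.
apply/allpairsP; exists (k, t); split=> //=; first by rewrite mem_iota; lia.
apply: IHps => //; last by lia.
apply/allP => x t_x; have := allP s_ps x; rewrite mem_cat t_x orbT => /(_ isT).
by case/predU1P=> // Dx; have := allP t_gt _ t_x; rewrite Dx /= ltnn.
Qed.

Lemma partseqs_uniq K ps : sorted ltn ps -> uniq (partseqs K ps).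
Proof.
elim: ps => // p ps IHps.
rewrite [sorted _ _]path_sortedE; last exact: ltn_trans.
move=> /andP[p_lt sorted_ps]; rewrite /= allpairs_uniq ?iota_uniq ?IHps //.
have count_t t : t \in partseqs K ps -> count_mem p t = 0.
  move=> /(partseqs_sound sorted_ps) /andP[_ t_ps]; apply/count_memPn/negP => /(allP t_ps).
  by move=> /(allP p_lt); rewrite /= ltnn.
move=> _ _ /allpairsP[[k t] /= [_ t_in ->]] /allpairsP[[k' t'] /= [_ t'_in ->]] /= E.
(* The tails do not contain [p], so counting [p] recovers its multiplicity. *)
have := congr1 (count_mem p) E.
rewrite !count_cat !count_nseq /= eqxx !count_t // !mul1n !addn0 => Dk.
by move/eqP: E; rewrite Dk eqseq_cat // eqxx => /eqP ->.
Qed.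

End PartsIn.

Section PartsGenFun.
Variables (R : comNzRingType) (q : R) (K : nat).
Hypothesis qK : q ^+ K = 0.

(** Each part contributes a truncated geometric series, and its remainder [q^(pK)] is 0. *)
Lemma gen_fun_partseqs ps : all (leq 1) ps ->
  gen_fun q (partseqs K ps) * \prod_(p <- ps) (1 - q ^+ p) = 1.
Proof.
elim: ps => [_|p ps IHps /andP[p_gt0 ps_gt0]].
  by rewrite /gen_fun big_seq1 big_nil mulr1.
have -> : gen_fun q (partseqs K (p :: ps)) =
    (\sum_(k <- iota 0 K) (q ^+ p) ^+ k) * gen_fun q (partseqs K ps).
  rewrite /gen_fun /= big_allpairs_dep mulr_suml; apply: eq_bigr => k _.
  rewrite mulr_sumr; apply: eq_bigr => s _.
  by rewrite sumn_cat sumn_nseq exprD exprM.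
have geom x m : (\sum_(k <- iota 0 m) x ^+ k) * (1 - x) = 1 - x ^+ m :> R.
  elim: m => [|m IHm]; first by rewrite big_nil mul0r subrr.
  by rewrite -addn1 iotaD big_cat big_seq1 /= add0n mulrDl IHm exprD expr1; ring.
rewrite big_cons mulrACA geom IHps // -exprM (expr_nilp qK) ?subr0 ?mulr1 //.
exact: leq_pmull.
Qed.

End PartsGenFun.

Definition parts23 (N : nat) : seq nat :=
  [seq x <- iota 0 (N * 5) | (x == 2 %[mod 5]) || (x == 3 %[mod 5])].

Lemma parts23_prod (R : comNzRingType) (q : R) N : \prod_(p <- parts23 N) (1 - q ^+ p) =
  \prod_(i < N) ((1 - q ^+ (i * 5 + 2)) * (1 - q ^+ (i * 5 + 3))).
Proof.
elim: N => [|N IHN]; first by rewrite big_nil big_ord0.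
have -> : parts23 N.+1 = parts23 N ++ [:: N * 5 + 2; N * 5 + 3]%N.
  rewrite /parts23 mulSn addnC iotaD filter_cat add0n; congr (_ ++ _).
  rewrite -[X in iota X]addn0 iotaDl filter_map.
  by under eq_filter => x do rewrite /= !modnMDl.
by rewrite big_ord_recr big_cat IHN !big_cons big_nil /= mulr1.
Qed.

Lemma card_B n N : (n < N * 5)%N ->
  B n = count (fun s => sumn s == n) (partseqs n.+1 (parts23 N)).
Proof.
move=> lt_nN.
have sorted_ps : sorted ltn (parts23 N).
  by rewrite sorted_filter ?iota_ltn_sorted //; apply: ltn_trans.
apply: (@card_partn n (all (fun x => (x == 2 %[mod 5]) || (x == 3 %[mod 5])))).
  exact: partseqs_uniq.
move=> s; apply/idP/idP.
  case/andP=> /and3P[sorted_s s_gt0 /eqP sum_s] s_23.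
  rewrite sum_s eqxx andbT; apply: partseqs_complete => //; last first.
    by rewrite ltnS -sum_s size_le_sumn.
  apply/allP => x s_x; rewrite inE mem_filter (allP s_23) // mem_iota.
  by have := mem_le_sumn s_x; rewrite sum_s; lia.
case/andP=> /(partseqs_sound sorted_ps)/andP[sorted_s s_ps] sum_s.
rewrite /is_partn sorted_s sum_s andbT /=; apply/andP; split.
  by apply: sub_all s_ps => x; rewrite inE mem_filter; case: x.
by apply: sub_all s_ps => x; rewrite inE mem_filter => /andP[].
Qed.

(** * Pairs of lists of opposite parity avoiding dominoes *)

Section DominoSequences.
Local Open Scope nat_scope.

Fixpoint parity_steps (c : nat) (s : seq nat) : bool :=
  if s is x :: s' then [&& c <= x, odd x == odd c & parity_steps x.+2 s'] else true.

(** The accumulator replaces the rank: started at 0 it equals [2j - 2] at the [j]-th entry, as for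
    [condC], and started at 2 it equals [2j], as for [condD]. *)
Fixpoint avoids (e : nat) (o ev : seq nat) : bool :=
  if o is x :: o' then
    [&& x + e - 1 \notin ev, x + e + 1 \notin ev & avoids e.+2 o' ev]
  else true.

(* With (c, e) = (2, 0) the components are the odd and the even parts, with
   (c, e) = (1, 2) the even and the odd parts. *)
Definition domino (c e : nat) (t : seq nat * seq nat) : bool :=
  [&& parity_steps c.+1 t.1, parity_steps (c + e) t.2 & avoids e t.1 t.2].

(* In the last case c + 1 is the first entry of the first component: its domino is
   {c + e, c + e + 2}, so the other parts resume at c + e + 4. *)
Fixpoint dominoes (n c e : nat) : seq (seq nat * seq nat) :=
  if n is n'.+1 then
    dominoes n' c.+2 e
    ++ [seq (t.1, c + e :: t.2) | t <- dominoes n' c.+2 e]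
    ++ [seq (c.+1 :: t.1, t.2) | t <- dominoes n' c.+2 e.+2]
  else [:: ([::], [::])].

Lemma parity_stepsW c s : parity_steps c.+2 s -> parity_steps c s.
Proof.
by case: s => //= x s /and3P[le_cx + ->]; rewrite negbK => ->; rewrite !andbT; lia.
Qed.

Lemma parity_stepsP c s : parity_steps c s ->
  parity_steps c.+2 s \/ exists2 s', s = c :: s' & parity_steps c.+2 s'.
Proof.
case: s => [|x s] /=; first by left.
case/and3P=> le_cx par_x steps_s; have [Dx|neq_xc] := eqVneq x c.
  by right; exists s; rewrite -Dx.
by left; rewrite negbK par_x steps_s !andbT; lia.
Qed.

Lemma parity_steps_ge c s x : parity_steps c s -> x \in s -> c <= x.
Proof.
elim: s c => //= y s IHs c /and3P[le_cy _ steps_s].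
by rewrite inE => /predU1P[-> //|/(IHs _ steps_s)]; lia.
Qed.

Lemma parity_steps_odd c s x : parity_steps c s -> x \in s -> odd x = odd c.
Proof.
elim: s c => //= y s IHs c /and3P[_ /eqP odd_y steps_s].
by rewrite inE => /predU1P[-> //|/(IHs _ steps_s)] /=; rewrite negbK => ->.
Qed.

Lemma parity_steps_sorted c s : parity_steps c s -> sorted ltn s.
Proof.
elim: s c => //= y s IHs c /and3P[_ _ steps_s]; rewrite (path_sortedE ltn_trans).
rewrite (IHs _ steps_s) andbT; apply/allP => x /(parity_steps_ge steps_s) /=; lia.
Qed.

Lemma sorted_parity_steps c s : sorted ltn s -> (forall x, x \in s -> c <= x) ->
  (forall x, x \in s -> odd x = odd c) -> parity_steps c s.
Proof.
elim: s c => //= y s IHs c; rewrite (path_sortedE ltn_trans) => /andP[/allP y_lt sorted_s].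
move=> c_le c_odd; have odd_y := c_odd y (mem_head _ _).
rewrite c_le ?mem_head // odd_y eqxx IHs //= => x s_x; last first.
  by rewrite negbK odd_y c_odd // inE s_x orbT.
have /= lt_yx := y_lt _ s_x; have := c_odd x; rewrite inE s_x orbT => /(_ isT) odd_x.
rewrite ltn_neqAle lt_yx andbT; apply/eqP => Dx.
by move: odd_x; rewrite -Dx /= odd_y; case: odd.
Qed.

(** Here [y] lies below every domino, as the accumulator only grows. *)
Lemma avoids_cons e o y ev : (forall x, x \in o -> y.+1 < x + e) ->
  avoids e o (y :: ev) = avoids e o ev.
Proof.
elim: o e => //= x o IHo e lt_y; have := lt_y x (mem_head _ _) => lt_yx.
rewrite IHo => [|z o_z]; last by have := lt_y z; rewrite inE o_z orbT => /(_ isT); lia.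
have [neq1 neq2] : x + e - 1 != y /\ x + e + 1 != y by split; lia.
by rewrite !inE (negPf neq1) (negPf neq2).
Qed.

Lemma dominoes_sound n c e t : t \in dominoes n c e -> domino c e t.
Proof.
elim: n c e t => [|n IHn] c e t /=; first by rewrite inE => /eqP ->.
rewrite !mem_cat => /or3P[/IHn|/mapP[t' /IHn + ->]|/mapP[t' /IHn + ->]]; case/and3P.
- by rewrite /domino addSn => /parity_stepsW -> /parity_stepsW -> ->.
- rewrite /domino /= !addSn leqnn eqxx => steps_o -> av /=.
  rewrite parity_stepsW // avoids_cons // => x /(parity_steps_ge steps_o); lia.
- rewrite /domino /= => steps_o; rewrite !addSn !addnS => steps_ev ->.
  rewrite leqnn eqxx steps_o (parity_stepsW (parity_stepsW steps_ev)) /= andbT.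
  by apply/andP; split; apply/negP => /(parity_steps_ge steps_ev); lia.
Qed.

Lemma dominoes_complete n c e t : domino c e t ->
    (forall x, x \in t.1 ++ t.2 -> x < c + n) -> t \in dominoes n c e.
Proof.
elim: n c e t => [|n IHn] c e [o ev] /and3P[/= steps_o steps_ev av] lt_t.
  case: o steps_o lt_t {av} => [_|x o /and3P[? _ _] /(_ x)]; last by rewrite inE eqxx; lia.
  case: ev steps_ev => // x ev /and3P[? _ _] /(_ x); rewrite inE eqxx; lia.
have lt2 x : x < c + n.+1 -> x < c.+2 + n by lia.
rewrite !mem_cat; have [steps_o'|[o' Do steps_o']] := parity_stepsP steps_o; last first.
  apply/or3P; apply: Or33; apply/mapP; exists (o', ev); rewrite ?Do //.
  move: av; rewrite Do /= => /and3P[av1 av2 av3].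
  apply: IHn => [|x t_x]; last by apply/lt2/lt_t; rewrite Do inE t_x orbT.
  rewrite /domino /= steps_o' av3 andbT !addSn !addnS.
  (* The domino of [c + 1] rules out first [c + e], then [c + e + 2]. *)
  have [steps_ev'|[ev' Dev]] := parity_stepsP steps_ev; last first.
    by move: av1; rewrite Dev addSn subn1 mem_head.
  have [//|[ev' Dev]] := parity_stepsP steps_ev'.
  by move: av2; rewrite Dev addSn addn1 mem_head.
have [steps_ev'|[ev' Dev steps_ev']] := parity_stepsP steps_ev.
  rewrite IHn // => [|x t_x]; last by apply/lt2/lt_t.
  by rewrite /domino /= steps_o' !addSn steps_ev' av.
apply/or3P; apply: Or32; apply/mapP; exists (o, ev'); rewrite ?Dev //.
apply: IHn => [|x t_x]; last first.
  by apply/lt2/lt_t; move: t_x; rewrite Dev !mem_cat inE => /orP[] ->; rewrite ?orbT.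
rewrite /domino /= steps_o' !addSn steps_ev' /=.
rewrite -(avoids_cons (y := c + e)) -?Dev // => x /(parity_steps_ge steps_o'); lia.
Qed.

(** Only the third branch has [c + 1] in the first component, and [c + e] in the second component
    separates the other two. *)
Lemma dominoes_uniq n c e : uniq (dominoes n c e).
Proof.
elim: n c e => // n IHn c e; rewrite /= !cat_uniq has_cat IHn.
rewrite !map_inj_uniq ?IHn => [|[? ?] [? ?] [-> ->] //|[? ?] [? ?] [-> ->] //].
have no_own t : t \in dominoes n c.+2 e -> c.+1 \notin t.1.
  by case/dominoes_sound/and3P=> steps_o _ _; apply/negP => /(parity_steps_ge steps_o); lia.
have no_other t : t \in dominoes n c.+2 e -> c + e \notin t.2.
  by case/dominoes_sound/and3P=> _ steps_ev _; apply/negP => /(parity_steps_ge steps_ev); lia.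
rewrite !andbT negb_or; apply/and3P; split=> //; first (apply/andP; split).
- by apply/hasPn => _ /mapP[t _ ->]; apply/negP => /no_other; rewrite mem_head.
- by apply/hasPn => _ /mapP[t _ ->]; apply/negP => /no_own; rewrite mem_head.
- apply/hasPn => _ /mapP[t _ ->]; apply/mapP => -[t' /no_own t'_own [Dt1 _]].
  by rewrite -Dt1 mem_head in t'_own.
Qed.

Definition merge_parts (t : seq nat * seq nat) : seq nat := sort leq (t.1 ++ t.2).

Definition split_parity (b : bool) (s : seq nat) : seq nat * seq nat :=
  ([seq x <- s | odd x == b], [seq x <- s | odd x != b]).

Lemma sumn_merge_parts t : sumn (merge_parts t) = sumn t.1 + sumn t.2.
Proof. by rewrite /merge_parts -sumn_cat; apply: perm_sumn; rewrite perm_sort. Qed.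

Lemma split_parityK b s : sorted leq s -> merge_parts (split_parity b s) = s.
Proof.
move=> sorted_s; rewrite -[RHS](sorted_sort leq_trans sorted_s).
by apply/(perm_sortP leq_total leq_trans anti_leq)/permPl/perm_filterC.
Qed.

Lemma merge_partsK b c e t : odd c.+1 = b -> odd (c + e) = ~~ b -> domino c e t ->
  split_parity b (merge_parts t) = t.
Proof.
case: t => o ev odd_own odd_other /and3P[/= steps_o steps_ev _].
have sort_id s : sorted ltn s -> sort leq s = s.
  by move=> sorted_s; apply/(sorted_sort leq_trans)/(sub_sorted ltnW sorted_s).
rewrite /split_parity /merge_parts !(filter_sort leq_total leq_trans) !filter_cat.
have fT (P : pred nat) s : {in s, forall x, P x} -> [seq x <- s | P x] = s.
  by move=> Ps; apply/all_filterP/allP.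
have fF (P : pred nat) s : {in s, forall x, ~~ P x} -> [seq x <- s | P x] = [::].
  by move=> Ps; rewrite (eq_in_filter (a2 := pred0)) ?filter_pred0 // => x /Ps/negPf.
pose own x := odd x == b; pose other x := odd x != b.
rewrite (fT own o) 1?(fF own ev) 1?(fF other o) 1?(fT other ev) => [|x|x|x|x].
- rewrite cats0 cat0s (sort_id _ (parity_steps_sorted steps_o)).
  by rewrite (sort_id _ (parity_steps_sorted steps_ev)).
- by move/(parity_steps_odd steps_ev); rewrite /own /other => ->; rewrite odd_other; case: (b).
- by move/(parity_steps_odd steps_o); rewrite /own /other => ->; rewrite odd_own negbK.
- by move/(parity_steps_odd steps_ev); rewrite /own /other => ->; rewrite odd_other; case: (b).
- by move/(parity_steps_odd steps_o); rewrite /own /other => ->; rewrite odd_own.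
Qed.

(** The numerical hypotheses cover [(c, e) = (2, 0)] and [(1, 2)] at once: [c + 1] and [c + e] are
    then 2 and 3 in some order, the least parts of their parity other than 1. *)
Lemma card_domino b c e n (condX : pred (seq nat)) :
    0 < c -> 1 < c + e -> c <= 2 -> c + e <= 3 -> odd c.+1 = b -> odd (c + e) = ~~ b ->
    (forall s, condX s = avoids e (split_parity b s).1 (split_parity b s).2) ->
  #|[set p : Defs.partn n | distinct_no_ones p && condX p]| =
  count (fun s => sumn s == n) (map merge_parts (dominoes n.+1 c e)).
Proof.
move=> c_gt0 ce_gt1 c_le2 ce_le3 odd_own odd_other condXE.
apply: (@card_partn n (fun s => distinct_no_ones s && condX s)).
  rewrite map_inj_in_uniq ?dominoes_uniq // => t1 t2 /dominoes_sound dom1 /dominoes_sound dom2 E.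
  by rewrite -(merge_partsK odd_own odd_other dom1) E (merge_partsK odd_own odd_other dom2).
move=> s; apply/idP/idP.
  case/andP=> /and3P[sorted_s s_gt0 /eqP sum_s] /andP[/andP[uniq_s no1] cond_s].
  rewrite sum_s eqxx andbT; apply/mapP; exists (split_parity b s); last by rewrite split_parityK.
  have s_gt1 x : x \in s -> 1 < x.
    move=> s_x; rewrite ltn_neqAle (allP s_gt0) // andbT.
    by apply: contraNneq no1 => ->.
  have lt_s P : sorted ltn (filter P s).
    by rewrite sorted_filter ?ltn_sorted_uniq_leq ?uniq_s //; apply: ltn_trans.
  apply: dominoes_complete => [|x]; last first.
    by rewrite mem_cat !mem_filter -andb_orl => /andP[_ /mem_le_sumn]; lia.
  rewrite /domino -condXE cond_s andbT.
  apply/andP; split; apply: (sorted_parity_steps (lt_s _)) => x;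
    rewrite mem_filter => /andP[/eqP odd_x].
  - by move/s_gt1; lia.
  - by rewrite odd_x odd_own.
  - move/s_gt1 => x_gt1; have [//|lt_x] := leqP (c + e) x.
    (* A part strictly between 1 and [c + e] could only be 2, which has the wrong parity when
       [c + e = 3]. *)
    have Dx : x = 2 by lia.
    have Dce : c + e = 3 by lia.
    by move: odd_x odd_other; rewrite Dx Dce; case: (b).
  - by rewrite odd_other; case: odd odd_x; case: (b).
case/andP=> /mapP[t /dominoes_sound dom Ds] sum_s.
have Dt := merge_partsK odd_own odd_other dom.
have /and3P[steps_o steps_ev av] := dom.
rewrite condXE Ds Dt av andbT -Ds /is_partn sum_s andbT Ds.
have t_gt1 x : x \in merge_parts t -> 1 < x.
  rewrite mem_sort mem_cat => /orP[/(parity_steps_ge steps_o)|/(parity_steps_ge steps_ev)]; lia.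
rewrite -andbA; apply/and3P; split; first exact: (sort_sorted leq_total).
  by apply/allP => x /t_gt1/ltnW.
rewrite /distinct_no_ones; apply/andP; split; last by apply/negP => /t_gt1.
rewrite sort_uniq cat_uniq !(sorted_uniq ltn_trans ltnn) //=; last first.
- exact: parity_steps_sorted steps_o.
- exact: parity_steps_sorted steps_ev.
rewrite andbT; apply/hasPn => x /(parity_steps_odd steps_ev) odd_x; apply/negP.
by move=> /(parity_steps_odd steps_o); rewrite odd_x odd_own odd_other; case: (b).
Qed.

Lemma avoidsE e o ev : avoids e o ev =
  all (fun j => (nth_part o j + e + 2 * j - 3 \notin ev)
             && (nth_part o j + e + 2 * j - 1 \notin ev)) (iota 1 (size o)).
Proof.
elim: o e => //= x o IHo e; rewrite IHo andbA; congr (_ && _).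
  rewrite /nth_part /= (_ : x + e + 2 * 1 - 3 = x + e - 1); last by lia.
  by rewrite (_ : x + e + 2 * 1 - 1 = x + e + 1) //; lia.
rewrite (iotaDl 1 1) all_map; apply: eq_in_all => -[|j]; rewrite mem_iota // => _ /=.
rewrite /nth_part /= (_ : nth 0 o j + e.+2 + 2 * j.+1 = nth 0 o j + e + 2 * j.+2) //; lia.
Qed.

(** [condC] tests membership in all of [s], [avoids] only among the even parts; the numbers tested
    are even, so this is the same. *)
Lemma condC_avoids s : condC s = avoids 0 (split_parity true s).1 (split_parity true s).2.
Proof.
have -> : split_parity true s = (odd_parts s, even_parts s).
  by congr (_, _); apply: eq_filter => x; case: odd.
rewrite avoidsE /condC; apply: eq_in_all => j; rewrite mem_iota /= => /andP[j_gt0 lt_j].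
have : nth_part (odd_parts s) j \in odd_parts s by rewrite mem_nth //; case: j j_gt0 lt_j.
rewrite !mem_filter addn0 => /andP[odd_x _].
have [-> ->] // : odd (nth_part (odd_parts s) j + 2 * j - 3) = false
  /\ odd (nth_part (odd_parts s) j + 2 * j - 1) = false.
move: (nth_part _ j) odd_x => x odd_x; rewrite -[x]odd_double_half odd_x.
split; [rewrite (_ : _ - 3 = (x./2 + j.-1).*2) | rewrite (_ : _ - 1 = (x./2 + j).*2)];
  by rewrite ?odd_double //; lia.
Qed.

Lemma condD_avoids s : condD s = avoids 2 (split_parity false s).1 (split_parity false s).2.
Proof.
have -> : split_parity false s = (even_parts s, odd_parts s).
  by congr (_, _); apply: eq_filter => x; case: odd.
rewrite avoidsE /condD; apply: eq_in_all => j; rewrite mem_iota /= => /andP[j_gt0 lt_j].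
have : nth_part (even_parts s) j \in even_parts s by rewrite mem_nth //; case: j j_gt0 lt_j.
rewrite !mem_filter => /andP[even_x _].
move: (nth_part _ j) even_x => x even_x.
have -> : x + 2 + 2 * j - 3 = x + 2 * j - 1 by lia.
have -> : x + 2 + 2 * j - 1 = x + 2 * j + 1 by lia.
have [-> ->] // : odd (x + 2 * j - 1) /\ odd (x + 2 * j + 1).
rewrite -[x]odd_double_half (negPf even_x).
split; [rewrite (_ : _ - 1 = (x./2 + j.-1).*2.+1) | rewrite (_ : _ + 1 = (x./2 + j).*2.+1)];
  by rewrite /= ?odd_double //; lia.
Qed.

End DominoSequences.

(** * The generating function of the domino scan *)

Section DominoGenFun.
Variables (R : comNzRingType) (q : R) (K : nat).
Hypothesis qK : q ^+ K = 0.

Definition domino_gf n c e : R := gen_fun q (map merge_parts (dominoes n c e)).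

Lemma domino_gfS n c e : domino_gf n.+1 c e =
  (1 + q ^+ (c + e)) * domino_gf n c.+2 e + q ^+ c.+1 * domino_gf n c.+2 e.+2.
Proof.
rewrite /domino_gf /= !map_cat !gen_fun_cat addrA /gen_fun !big_map; congr (_ + _).
  rewrite mulrDl mul1r; congr (_ + _); rewrite mulr_sumr; apply: eq_bigr => t _.
  by rewrite !sumn_merge_parts /= -exprD; congr (_ ^+ _); lia.
rewrite mulr_sumr; apply: eq_bigr => t _.
by rewrite !sumn_merge_parts /= -exprD; congr (_ ^+ _); lia.
Qed.

Lemma domino_gf_big n c e : (K <= c)%N -> domino_gf n c e = 1.
Proof.
elim: n c e => [|n IHn] c e le_Kc; first by rewrite /domino_gf /gen_fun big_seq1.
rewrite domino_gfS !IHn ?(leqW, leqW) // !(expr_nilp qK) ?leqW //; last exact: leq_trans (leq_addr _ _).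
by rewrite mul0r !addr0 mulr1.
Qed.

(** Pairs present on one side only have an entry at least [c + n], hence weight 0. *)
Lemma domino_gf_stable n c e : (K <= c + n)%N -> domino_gf n.+1 c e = domino_gf n c e.
Proof.
elim: n c e => [|n IHn] c e le_K; first by rewrite !domino_gf_big // -[c]addn0.
by rewrite [LHS]domino_gfS [RHS]domino_gfS !IHn //; lia.
Qed.

Lemma domino_gf_rec c e : domino_gf K c e =
  (1 + q ^+ (c + e)) * domino_gf K c.+2 e + q ^+ c.+1 * domino_gf K c.+2 e.+2.
Proof. by rewrite -domino_gf_stable ?leq_addl // domino_gfS. Qed.

End DominoGenFun.

(* Comparison of the four counts *)
Local Close Scope ring_scope.

Theorem theorem5 (n : nat) (hn : 0 < n) :
  A n = B n /\ B n = C n /\ C n = D n.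
Proof.
pose N := (n.+1 + n.+1)%N.
have lt_nN : (n < N * 5)%N by rewrite /N; lia.
have EC : C n = count (fun s => sumn s == n) (map merge_parts (dominoes n.+1 2 0)).
  exact: card_domino condC_avoids.
have ED : D n = count (fun s => sumn s == n) (map merge_parts (dominoes n.+1 1 2)).
  exact: card_domino condD_avoids.
have gap_rec (R : comNzRingType) (q : R) (qn : (q ^+ n.+1 = 0)%R) := gen_fun_gapseqs_rec qn.
have gap_big (R : comNzRingType) (q : R) (qn : (q ^+ n.+1 = 0)%R) := gen_fun_gapseqs_big qn n.+1.
have AB : A n = B n.
  rewrite card_A (card_B lt_nN); apply: count_gen_fun => R q qn.
  have := rogers_ramanujan qn (gap_big R q qn) (gap_rec R q qn).
  rewrite -parts23_prod => EA.
  have EB : (gen_fun q (partseqs n.+1 (parts23 N)) * \prod_(p <- parts23 N) (1 - q ^+ p) = 1)%R.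
    apply: (gen_fun_partseqs qn); apply/allP => x.
    by rewrite mem_filter; case: x.
  (* Both generating functions are inverse to the same product, hence equal. *)
  by rewrite -[LHS]mulr1 -EB mulrCA EA mulr1.
have AC : A n = C n.
  rewrite card_A EC; apply: count_gen_fun => R q qn; symmetry.
  apply: (domino_w20 qn (gap_big R q qn) (gap_rec R q qn) (domino_gf_big qn n.+1)).
  exact: domino_gf_rec.
have AD : A n = D n.
  rewrite card_A ED; apply: count_gen_fun => R q qn; symmetry.
  apply: (domino_w12 qn (gap_big R q qn) (gap_rec R q qn) (domino_gf_big qn n.+1)).
  exact: domino_gf_rec.
by rewrite -AB -AC -AD.
Qed.
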